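(* For any $n\in\mathbb Z_{\ge1}$ and $A\in\mathbb R_{>0}$, there exists $R\in\mathbb R_{>0}$ with the following property. For any $\Lambda_0\in\mathbb C^n_0/W$ with $\Lambda_0=-\overline{\Lambda_0}$, there exists an entire function $h:\mathbb C^n_0/W\to\mathbb C$ satisfying the Paley--Wiener condition $$h(\Lambda)\ll_{A,\Lambda_0}e^{R\|\operatorname{Re}\Lambda\|}(1+\|\Lambda\|)^{-A},\qquad\Lambda\in\mathbb C_0^n/W,$$ and the bounds $$0\le h(\Lambda)\ll_A(1+d(\Lambda_0,\Lambda))^{-A},\qquad\Lambda=-\overline\Lambda,\quad\operatorname{Re}\Lambda\preceq\operatorname{Re}\Lambda_0,$$ $$0\le h(\Lambda)\ll_A\exp\bigl(-A\cdot d(\operatorname{Re}\Lambda_0,\operatorname{Re}\Lambda)\bigr),\qquad\Lambda=-\overline\Lambda,\quad\operatorname{Re}\Lambda\preceq\operatorname{Re}\Lambda_0,$$ $$h(\Lambda_0)\asymp_A1.$$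
   Context: $W=S_n$ acts on $\mathbb C^n$ by permuting coordinates; $\mathbb C^n_0=\{z\in\mathbb C^n:\sum_jz_j=0\}$. An entire function on $\mathbb C_0^n/W$ is a $W$-invariant entire function on $\mathbb C_0^n$. For $\Lambda=(\mathbf u+i\mathbf v)W$ with $\mathbf u,\mathbf v\in\mathbb R^n$: $\operatorname{Re}\Lambda=\mathbf uW$, $-\overline\Lambda=(-\mathbf u+i\mathbf v)W$, and $\|\Lambda\|$, $\|\operatorname{Re}\Lambda\|$ are the Euclidean norms of representatives. $d(\Lambda,\Lambda')$ is the minimum of the Euclidean distances between a representative of $\Lambda$ and a representative of $\Lambda'$. For $\mathbf a,\mathbf a'\in\mathbb R^n$, $\mathbf a'W\preceq\mathbf aW$ means: there exists $w\in W$ such that for any $w'\in W$ and $1\le k\le n$, $\sum_{j=1}^ka'_{w'(j)}\le\sum_{j=1}^ka_{w(j)}$. $X\ll_DY$ means $|X|\le CY$ with a constant $C>0$ depending only on $D$ and $n$; $X\asymp_DY$ means $X\ll_DY$ and $Y\ll_DX$. *)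

(* Defs.v *)
From HB Require Import structures.
From mathcomp Require Import all_boot all_order all_algebra all_fingroup.
From mathcomp Require Import all_classical all_reals all_analysis.
From mathcomp Require Import complex.

Set Implicit Arguments.
Unset Strict Implicit.
Unset Printing Implicit Defensive.

Import Order.TTheory GRing.Theory Num.Theory.
Import numFieldNormedType.Exports.
Import ComplexField.Normc.

Local Open Scope classical_set_scope.
Local Open Scope complex_scope.
Local Open Scope ring_scope.

Definition sum_zero (K : pzRingType) (n : nat) : {pred 'rV[K]_n} :=
  [pred z : 'rV[K]_n | \sum_(j < n) z ord0 j == 0].

Fact sum_zero_submod_closed (K : pzRingType) (n : nat) :
  submod_closed (@sum_zero K n).
Proof.
split; first by rewrite inE big1 // => j _; rewrite mxE.
move=> a u v; rewrite !inE => /eqP u0 /eqP v0.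
under eq_bigr do rewrite !mxE.
by rewrite big_split /= -mulr_sumr u0 v0 mulr0 addr0.
Qed.

HB.instance Definition _ (K : pzRingType) (n : nat) :=
  GRing.isSubmodClosed.Build K 'rV[K]_n (@sum_zero K n)
    (@sum_zero_submod_closed K n).

(* The complex vector space C^n_0, as a normed space over R[i]: it carries the
   restriction of the sup norm of 'rV[R[i]]_n, so [differentiable] on [C0 R n]
   is complex Frechet differentiability. *)
Record C0 (R : realType) (n : nat) : Type := MkC0 {
  C0val :> 'rV[R[i]]_n;
  C0valP : C0val \in @sum_zero R[i] n
}.

HB.instance Definition _ (R : realType) (n : nat) := [isSub for @C0val R n].
HB.instance Definition _ (R : realType) (n : nat) :=
  [Choice of C0 R n by <:].
HB.instance Definition _ (R : realType) (n : nat) :=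
  [SubChoice_isSubLmodule of C0 R n by <:].

Section C0_normed.
Variables (R : realType) (n : nat).

Let norm0 (z : C0 R n) : R[i] := `|C0val z|.

Let norm0D (x y : C0 R n) : norm0 (x + y) <= norm0 x + norm0 y.
Proof. exact: ler_normD. Qed.

Let norm0Z (l : R[i]) (x : C0 R n) : norm0 (l *: x) = `|l| * norm0 x.
Proof. exact: normrZ. Qed.

Let norm0_eq0 (x : C0 R n) : norm0 x = 0 -> x = 0.
Proof. by move=> /normr0_eq0 x0; apply: val_inj. Qed.

HB.instance Definition _ :=
  Lmodule_isNormed.Build R[i] (C0 R n) norm0D norm0Z norm0_eq0.

End C0_normed.

Fact sum_zero_perm (R : realType) (n : nat) (w : 'S_n) (z : C0 R n) :
  col_perm w z \in @sum_zero R[i] n.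
Proof.
rewrite inE; apply/eqP; under eq_bigr do rewrite mxE.
rewrite -[RHS](eqP (C0valP z)) [RHS](reindex_inj (@perm_inj _ w)).
exact: eq_bigr.
Qed.

Definition C0_perm (R : realType) (n : nat) (w : 'S_n) (z : C0 R n) : C0 R n :=
  MkC0 (sum_zero_perm w z).

(* An entire function on C^n_0 / W.  Throughout, a point zW of the quotient is
   given by a representative z. *)
Definition entire_mod_W (R : realType) (n : nat) (h : C0 R n -> R[i]) : Prop :=
  (forall z : C0 R n, differentiable (h : C0 R n -> R[i]^o) z) /\
  (forall (w : 'S_n) (z : C0 R n), h (C0_perm w z) = h z).

Definition W_orbit (T : Type) (n : nat) (z : 'rV[T]_n) : set 'rV[T]_n :=
  [set col_perm w z | w in [set: 'S_n]].

(* The condition Lambda = - conj Lambda, an equality of orbits. *)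
Definition neg_conj_fixed (R : realType) (n : nat) (z : 'rV[R[i]]_n) : Prop :=
  W_orbit z = W_orbit (- map_mx (@conjc R) z).

Definition Re_vec (R : realType) (n : nat) (z : 'rV[R[i]]_n) : 'rV[R]_n :=
  map_mx (@complex.Re R) z.

Definition enormC (R : realType) (n : nat) (z : 'rV[R[i]]_n) : R :=
  Num.sqrt (\sum_(j < n) normc (z ord0 j) ^+ 2).

Definition enormR (R : realType) (n : nat) (x : 'rV[R]_n) : R :=
  Num.sqrt (\sum_(j < n) x ord0 j ^+ 2).

(* The default value of the iterated minimum is the term of the pair (1, 1). *)
Definition orbit_dist (R : realType) (V : zmodType) (n : nat)
    (N : 'rV[V]_n -> R) (z z' : 'rV[V]_n) : R :=
  \big[Num.min/N (z - z')]_(p : 'S_n * 'S_n)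
     N (col_perm p.1 z - col_perm p.2 z').

Definition distC (R : realType) (n : nat) (z z' : 'rV[R[i]]_n) : R :=
  orbit_dist (@enormC R n) z z'.

Definition distR (R : realType) (n : nat) (x x' : 'rV[R]_n) : R :=
  orbit_dist (@enormR R n) x x'.

Definition majorized (R : realType) (n : nat) (a' a : 'rV[R]_n) : Prop :=
  exists w : 'S_n, forall (w' : 'S_n) (k : nat), (1 <= k <= n)%N ->
    \sum_(j < n | (j < k)%N) a' ord0 (w' j)
      <= \sum_(j < n | (j < k)%N) a ord0 (w j).

(* Main.v *)
Require Import Defs.
From HB Require Import structures.
From mathcomp Require Import all_boot all_order all_algebra all_fingroup.
From mathcomp Require Import all_classical all_reals all_analysis.
From mathcomp Require Import complex.
From mathcomp Require Import ring lra zify.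

Set Implicit Arguments.
Unset Strict Implicit.
Unset Printing Implicit Defensive.

Import Order.TTheory GRing.Theory Num.Theory.
Import numFieldNormedType.Exports.
Import ComplexField.Normc.

Local Open Scope complex_scope.
Local Open Scope ring_scope.

(* For an entire f of exponential type, g(z) = sum_w f(w z - z0) is entire and
   W-invariant, and so is h(z) = g(z) conj(g(- conj z)). At every
   Lambda = - conj Lambda one has h = |g|^2 >= 0, so only upper bounds for g and
   a lower bound for |g(z0)| are needed.

   Take f = phi^s with
     phi(z) = exp(M sum_j (n - j) z_j) prod_j (sinh(z_j) / z_j)^m  (0 <= j < n)
   and order z0 so that Re z0 is decreasing. Each z_j occurs in n - j partial
   sums z_0 + ... + z_{k-1}, so at w z - z0 the first exponent has real part M
   times the sum of the partial sums of Re (w z - z0), all nonpositive when Re z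
   is majorized by Re z0. For M large this beats the exponential growth of sinh,
   while the factors 1 / z_j give the polynomial decay.

   The summands of g(z0) are the s-th powers of n! numbers, one of which is
   phi(0) = 1. They may cancel for a given s, but by Turan's power sum theorem
   not for all s in {1, ..., n!}; s is chosen according to z0. *)

(** * The complex exponential and the function sinh(z)/z *)

Section ComplexExponential.
Variable R : realType.
Implicit Types (x y : R) (z : R[i]).

Definition cexp z : R[i] :=
  (expR (complex.Re z) * cos (complex.Im z)) +i*
  (expR (complex.Re z) * sin (complex.Im z)).

Definition csinh z : R[i] := (cexp z - cexp (- z)) / 2.

Definition csinhc z : R[i] := if z == 0 then 1 else csinh z / z.

Lemma cexp0 : cexp 0 = 1.
Proof. by rewrite /cexp /= expR0 cos0 sin0 mulr1 mulr0. Qed.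

Lemma cexpD z1 z2 : cexp (z1 + z2) = cexp z1 * cexp z2.
Proof.
case: z1 z2 => [x1 y1] [x2 y2]; rewrite /cexp; simpc.
rewrite /= expRD cosD sinD; apply/eqP; rewrite eq_complex /=.
by apply/andP; split; apply/eqP; ring.
Qed.

Lemma normc_ge0 z : 0 <= normc z.
Proof. by case: z => a b; exact: sqrtr_ge0. Qed.

Lemma normr_normc z : `|z| = (normc z)%:C.
Proof. by case: z => a b; rewrite normc_def. Qed.

Lemma sqr_normcE z : normc z ^+ 2 = complex.Re z ^+ 2 + complex.Im z ^+ 2.
Proof. by case: z => a b; rewrite sqr_sqrtr ?addr_ge0 ?sqr_ge0. Qed.

Lemma normc_le z x : 0 <= x ->
  complex.Re z ^+ 2 + complex.Im z ^+ 2 <= x ^+ 2 -> normc z <= x.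
Proof.
move=> x0; rewrite -sqr_normcE => h.
by rewrite -(ler_pXn2r (n := 2))// nnegrE ?normc_ge0.
Qed.

Lemma abs_Re_le z : `|complex.Re z| <= normc z.
Proof.
rewrite -(ler_pXn2r (n := 2))// ?nnegrE ?normc_ge0//.
by rewrite sqr_normcE real_normK ?num_real// lerDl sqr_ge0.
Qed.

Lemma abs_Im_le z : `|complex.Im z| <= normc z.
Proof.
rewrite -(ler_pXn2r (n := 2))// ?nnegrE ?normc_ge0//.
by rewrite sqr_normcE real_normK ?num_real// lerDr sqr_ge0.
Qed.

Lemma normc_cexp z : normc (cexp z) = expR (complex.Re z).
Proof.
apply: (@pexpIrn _ 2) => //; rewrite ?nnegrE ?normc_ge0 ?expR_ge0//.
by rewrite sqr_normcE /= !exprMn -mulrDr cos2Dsin2 mulr1.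
Qed.

Lemma conjc_cexp z : (cexp z)^* = cexp z^*.
Proof. by case: z => x y; rewrite /cexp /= cosN sinN mulrN. Qed.

Lemma expR_sub1_ge x : x <= expR x - 1.
Proof. by have := expR_ge1Dx x; lra. Qed.

Lemma expR_sub1_le x : expR x - 1 <= x * expR x.
Proof.
have := expR_ge1Dx (- x); rewrite expRN => h.
have e0 := expR_gt0 x.
have : (1 - x) * expR x <= 1 by rewrite -ler_pdivlMr// div1r.
by rewrite mulrBl mul1r; lra.
Qed.

(** By [expR_sub1_le] the left side is at most x (e^x - 1); for x < 0 this is at most x^2 because
    e^x - 1 >= x. *)
Lemma expR_sub1Dx_le x : expR x - 1 - x <= x ^+ 2 * expR `|x|.
Proof.
have h1 := expR_sub1_le x; have h2 := expR_sub1_ge x.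
have h3 : 1 <= expR `|x| by rewrite -[leLHS]expR0 ler_expR.
apply: (@le_trans _ _ (x * (expR x - 1))); first by lra.
have [x0|x0] := leP 0 x.
  by rewrite ger0_norm// expr2 -mulrA ler_wpM2l.
apply: (@le_trans _ _ (x ^+ 2)); last by rewrite ler_peMr// sqr_ge0.
by rewrite expr2 ler_wnM2l// ltW.
Qed.

Lemma abs_sin_le x : `|sin x| <= `|x|.
Proof.
wlog x0 : x / 0 < x.
  move=> H; have [x0|x0|<-] := ltgtP 0 x; first exact: H.
    by rewrite -normrN -sinN -[leRHS]normrN; apply: H; lra.
  by rewrite sin0 !normr0.
have dsin c : c \in `]0, x[ -> is_derive c 1 (@sin R) (cos c).
  by move=> _; exact: is_derive_sin.
have [|c _] := MVT x0 dsin.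
  by apply: continuous_subspaceT => c; exact: continuous_sin.
rewrite sin0 !subr0 => ->; rewrite normrM ler_piMl//; exact: cos_max.
Qed.

Lemma oneB_cos_le x : 1 - cos x <= x ^+ 2 / 2.
Proof.
have -> : cos x = 1 - 2 * sin (x / 2) ^+ 2.
  have {1}-> : x = (x / 2) *+ 2 by rewrite -mulr_natr; field.
  by rewrite cos_mulr2n cos2sin2; ring.
have : sin (x / 2) ^+ 2 <= (x / 2) ^+ 2.
  rewrite -(real_normK (num_real (sin _))) -(real_normK (num_real (x / 2))).
  by rewrite ler_pXn2r// ?nnegrE// abs_sin_le.
by lra.
Qed.

(** The mean value theorem gives sin x - x = (cos c - 1) x with |c| < |x|, and 1 - cos c <= c^2 / 2.
    The order 3 matters later, the constant does not. *)
Lemma abs_sinB_le x : `|sin x - x| <= `|x| ^+ 3.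
Proof.
wlog x0 : x / 0 < x.
  move=> H; have [x0|x0|<-] := ltgtP 0 x; first exact: H.
    have -> : sin x - x = - (sin (- x) - (- x)) by rewrite sinN; ring.
    by rewrite normrN -(normrN x); apply: H; lra.
  by rewrite sin0 subrr normr0 expr0n.
have dsinB c : c \in `]0, x[ ->
    is_derive c 1 (fun t : R => sin t - t) (cos c - 1).
  by move=> _; apply: is_deriveB.
have [|c cx] := MVT x0 dsinB.
  apply: derivable_within_continuous => c _.
  by apply: derivableB => //; exact: derivable_sin.
rewrite sin0 subrr !subr0 => ->; rewrite normrM exprSr.
apply: ler_wpM2r => //.
have := oneB_cos_le c; have := cos_le1 c.
move: cx; rewrite in_itv /= => /andP[c0 cx] h1 h2.
rewrite ler0_norm ?(gtr0_norm x0); last by lra.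
nra.
Qed.

Lemma coshB1_ge0 x : 0 <= (expR x + expR (- x)) / 2 - 1.
Proof. by have := expR_ge1Dx x; have := expR_ge1Dx (- x); lra. Qed.

Lemma coshB1_le x : (expR x + expR (- x)) / 2 - 1 <= x ^+ 2 * expR `|x|.
Proof.
have := expR_sub1Dx_le x; have := expR_sub1Dx_le (- x).
by rewrite sqrrN normrN; lra.
Qed.

Lemma abs_sinhB_le x :
  `|(expR x - expR (- x)) / 2 - x| <= `|x| ^+ 3 * expR `|x|.
Proof.
wlog x0 : x / 0 < x.
  move=> H; have [x0|x0|<-] := ltgtP 0 x; first exact: H.
    have -> : (expR x - expR (- x)) / 2 - x =
              - ((expR (- x) - expR (- (- x))) / 2 - (- x)).
      by rewrite opprK; field.
    by rewrite normrN -(normrN x); apply: H; lra.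
  by rewrite oppr0 !subrr mul0r addr0 normr0 expr0n mul0r.
pose F (t : R) := (expR t - expR (- t)) / 2 - t.
pose dF (t : R) := (expR t + expR (- t)) / 2 - 1.
have dFE (c : R) : is_derive c 1 F (dF c).
  have h : is_derive c 1 (fun t : R => expR (- t)) (- expR (- c)).
    apply: trigger_derive; rewrite /GRing.scale /=; ring.
  rewrite /F /dF; apply: is_deriveB.
  have -> : (fun t : R => (expR t - expR (- t)) / 2) =
            2^-1 *: ((@expR R) - (fun t => expR (- t))).
    by apply/funext => t /=; rewrite /= mulrC.
  apply: is_derive_eq; rewrite /GRing.scale /=; ring.
have [|c cx] := @MVT R F dF 0 x x0 (fun c _ => dFE c).
  by apply: derivable_within_continuous => c _; exact: ex_derive.
have F0 : F 0 = 0 by rewrite /F /= oppr0 subrr mul0r addr0.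
rewrite F0 !subr0 -/(F x) => ->; rewrite normrM exprSr.
rewrite mulrAC; apply: ler_wpM2r => //.
rewrite ger0_norm ?coshB1_ge0// (le_trans (coshB1_le c))//.
move: cx; rewrite in_itv /= => /andP[c0 cx].
apply: ler_pM; rewrite ?sqr_ge0 ?expR_ge0// ?ler_expR !gtr0_norm// 1?ltW//.
by rewrite ltr_pXn2r// nnegrE ltW.
Qed.

Lemma normc_le_abs z : normc z <= `|complex.Re z| + `|complex.Im z|.
Proof.
apply: normc_le; first by rewrite addr_ge0.
rewrite sqrrD !real_normK ?num_real// -addrA lerD2l lerDr.
by rewrite mulrn_wge0// mulr_ge0.
Qed.

(** The real part is (e^x - 1 - x) - e^x (1 - cos y) and the imaginary part (e^x - 1) sin y + (sin y
    - y); every term is of second order. This will give the derivative of [cexp] at 0. *)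
Lemma normc_cexp_sub1B_le z : normc z <= 1 ->
  normc (cexp z - 1 - z) <= 4 * expR 1 * normc z ^+ 2.
Proof.
move=> z1; apply: (le_trans (normc_le_abs _)).
have := abs_Re_le z; have := abs_Im_le z; have := sqr_normcE z.
move: z1; case: z => x y; set n := normc _ => n1 /= nE yn xn; rewrite !subr0.
set E := expR 1.
have E1 : 1 <= E by rewrite -[leLHS]expR0 ler_expR.
have xE : expR `|x| <= E by rewrite ler_expR (le_trans xn).
have exE : expR x <= E by rewrite (le_trans _ xE)// ler_expR ler_norm.
have x20 := sqr_ge0 x; have y20 := sqr_ge0 y.
have re : `|expR x * cos y - 1 - x| <= E * (x ^+ 2 + y ^+ 2).
  have -> : expR x * cos y - 1 - x =
    (expR x - 1 - x) - expR x * (1 - cos y) by ring.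
  rewrite (le_trans (ler_normB _ _))// [leRHS]mulrDr lerD//.
    rewrite ger0_norm; last by have := expR_sub1_ge x; lra.
    by rewrite (le_trans (expR_sub1Dx_le _))// mulrC ler_wpM2r.
  rewrite ger0_norm ?mulr_ge0 ?expR_ge0 ?subr_ge0 ?cos_le1//.
  apply: ler_pM; rewrite ?expR_ge0 ?subr_ge0 ?cos_le1//.
  by have := oneB_cos_le y; lra.
have im : `|expR x * sin y - y| <= 2 * E * (x ^+ 2 + y ^+ 2).
  have -> : expR x * sin y - y = (expR x - 1) * sin y + (sin y - y) by ring.
  rewrite (le_trans (ler_normD _ _))//.
  have h1 : `|(expR x - 1) * sin y| <= E * (x ^+ 2 + y ^+ 2).
    rewrite normrM; apply: (@le_trans _ _ (`|x| * E * `|y|)).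
      apply: ler_pM; rewrite ?abs_sin_le//.
      have h1 := expR_sub1_ge x; have h2 := expR_sub1_le x.
      have [x0|x0] := leP 0 x.
        rewrite ger0_norm ?(le_trans x0 h1)// (le_trans h2)//.
        by rewrite (ger0_norm x0) ler_wpM2l.
      have ex1 : expR x < 1 by rewrite expR_lt1.
      rewrite ler0_norm; last by lra.
      apply: (@le_trans _ _ (- x)); first by lra.
      by rewrite (ltr0_norm x0) ler_peMr// oppr_ge0 ltW.
    rewrite mulrAC mulrC ler_wpM2l ?(le_trans ler01)//.
    rewrite -(real_normK (num_real x)) -(real_normK (num_real y)).
    by have := sqr_ge0 (`|x| - `|y|); nra.
  have h2 : `|sin y - y| <= E * (x ^+ 2 + y ^+ 2).
    rewrite (le_trans (abs_sinB_le _))//.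
    apply: (@le_trans _ _ (y ^+ 2)).
      by rewrite exprSr real_normK ?num_real// ler_piMr// (le_trans yn).
    by nra.
  by lra.
by rewrite nE; nra.
Qed.

Lemma csinhE x y : csinh (x +i* y) =
  ((expR x - expR (- x)) / 2 * cos y) +i*
  ((expR x + expR (- x)) / 2 * sin y).
Proof.
have E2 : (2 : R[i])^-1 = (2^-1)%:C by rewrite rmorphV ?unitfE ?rmorph_nat.
rewrite /csinh /cexp E2 /= cosN sinN; simpc.
by apply/eqP; rewrite eq_complex /=; apply/andP; split; apply/eqP; ring.
Qed.

(** Real and imaginary parts split into four terms, each at most e |z|^3. After division by z an
    error of order 2 remains, so [csinhc] has derivative 0 at 0. *)
Lemma normc_csinhB_le z : normc z <= 1 ->
  normc (csinh z - z) <= 4 * expR 1 * normc z ^+ 3.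
Proof.
move=> z1; apply: (le_trans (normc_le_abs _)).
have := abs_Re_le z; have := abs_Im_le z; have := normc_ge0 z.
move: z1; case: z => x y; set n := normc _ => n1 n0.
rewrite csinhE => /= yn xn.
set E := expR 1.
have E1 : 1 <= E by rewrite -[leLHS]expR0 ler_expR.
have E0 : 0 <= E by exact: le_trans E1.
have xE : expR `|x| <= E by rewrite ler_expR (le_trans xn).
have y2 : y ^+ 2 <= n ^+ 2.
  by rewrite -(real_normK (num_real y)) ler_pXn2r ?nnegrE.
have x2 : x ^+ 2 <= n ^+ 2.
  by rewrite -(real_normK (num_real x)) ler_pXn2r ?nnegrE.
have n3E : n ^+ 3 <= E * n ^+ 3 by rewrite ler_peMl// exprn_ge0.
set sh := (expR x - _) / 2; set ch := (expR x + _) / 2.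
have re1 : `|(sh - x) * cos y| <= E * n ^+ 3.
  rewrite normrM -[leRHS]mulr1; apply: ler_pM; rewrite ?cos_max//.
  rewrite (le_trans (abs_sinhB_le _))// mulrC; apply: ler_pM => //.
  by rewrite ler_pXn2r ?nnegrE.
have re2 : `|x * (1 - cos y)| <= n ^+ 3.
  rewrite normrM exprS; apply: ler_pM => //.
  rewrite ger0_norm ?subr_ge0 ?cos_le1// (le_trans (oneB_cos_le y))//.
  by have := sqr_ge0 y; lra.
have im1 : `|(ch - 1) * sin y| <= E * n ^+ 3.
  rewrite normrM exprSr mulrA; apply: ler_pM => //.
    rewrite ger0_norm ?coshB1_ge0// (le_trans (coshB1_le _))// mulrC.
    by apply: ler_pM; rewrite ?expR_ge0 ?sqr_ge0.
  exact: le_trans (abs_sin_le y) yn.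
have im2 : `|sin y - y| <= n ^+ 3.
  by rewrite (le_trans (abs_sinB_le _))// ler_pXn2r ?nnegrE.
have -> : sh * cos y - x = (sh - x) * cos y - x * (1 - cos y) by ring.
have -> : ch * sin y - y = (ch - 1) * sin y + (sin y - y) by ring.
rewrite (le_trans (lerD (ler_normB _ _) (ler_normD _ _)))//.
by rewrite -mulrA; lra.
Qed.

Lemma sinh_sqr_le x : ((expR x - expR (- x)) / 2) ^+ 2 <=
  x ^+ 2 * expR `|x| ^+ 2.
Proof.
wlog x0 : x / 0 <= x.
  move=> H; have [x0|x0] := leP 0 x; first exact: H.
  rewrite -(sqrrN x) -normrN -sqrrN.
  rewrite -mulNr opprB -[X in _ - expR X]opprK.
  by apply: H; rewrite oppr_ge0 ltW.
rewrite ger0_norm// -exprMn ler_pXn2r ?nnegrE ?mulr_ge0 ?expR_ge0//; last first.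
  by rewrite subr_ge0 ler_expR; lra.
have := expR_sub1_le x; have := expR_ge1Dx (- x).
have : x <= x * expR x by rewrite ler_peMr// -[leLHS]expR0 ler_expR.
by lra.
Qed.

(** This rests on |sinh(x + iy)|^2 = sinh(x)^2 + sin(y)^2. *)
Lemma normc_csinh_le z : normc (csinh z) <= normc z * expR `|complex.Re z|.
Proof.
apply: normc_le; first by rewrite mulr_ge0 ?normc_ge0 ?expR_ge0.
rewrite exprMn sqr_normcE; case: z => x y; rewrite csinhE /=.
set sh := (expR x - _) / 2; set ch := (expR x + _) / 2.
have chE : ch ^+ 2 = 1 + sh ^+ 2.
  have := expRxMexpNx_1 x; rewrite /ch /sh.
  set a := expR x; set b := expR (- x) => ab.
  have -> : ((a + b) / 2) ^+ 2 = a * b + ((a - b) / 2) ^+ 2 by field.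
  by rewrite ab.
have -> : (sh * cos y) ^+ 2 + (ch * sin y) ^+ 2 = sh ^+ 2 + sin y ^+ 2.
  by rewrite [(sh * _) ^+ 2]exprMn [(ch * _) ^+ 2]exprMn chE cos2sin2; ring.
rewrite mulrDl lerD ?sinh_sqr_le//.
have E1 : 1 <= expR `|x| ^+ 2 by rewrite exprn_ege1// -[leLHS]expR0 ler_expR.
apply: (@le_trans _ _ (y ^+ 2)); last by rewrite ler_peMr ?sqr_ge0.
rewrite -(real_normK (num_real y)) -(real_normK (num_real (sin _))).
by rewrite ler_pXn2r ?nnegrE// abs_sin_le.
Qed.

Lemma normc_csinh_le_exp z : normc (csinh z) <= expR `|complex.Re z|.
Proof.
have H z' : normc (cexp z') <= expR `|complex.Re z'|.
  by rewrite normc_cexp ler_expR ler_norm.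
have E2 : normc (2 : R[i])^-1 = 2^-1.
  by rewrite normcV (normcMn 1 2) normc1.
rewrite /csinh normcM E2 ler_pdivrMr// (le_trans (le_normcD _ _))//.
rewrite normcN mulr_natr mulr2n lerD// (le_trans (H _))//.
by case: z => a b /=; rewrite normrN.
Qed.

(** The 1 in 1 + |z| is paid for by |sinh z| <= |z| e^|Re z|, the |z| by |sinh z| <= e^|Re z|. This
    is the source of all polynomial decay below. *)
Lemma normc_csinhc_le z :
  normc (csinhc z) * (1 + normc z) <= 2 * expR `|complex.Re z|.
Proof.
have E1 : 1 <= expR `|complex.Re z| by rewrite -[leLHS]expR0 ler_expR.
rewrite /csinhc; case: ifPn => [/eqP ->|z0].
  rewrite normc0 addr0 mulr1 normc1; move: E1; rewrite /= normr0 expR0; lra.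
have nz : 0 < normc z.
  by rewrite lt_neqAle normc_ge0 andbT eq_sym; apply: contraNneq z0 => /eq0_normc ->.
rewrite mulrDr mulr1 [leRHS]mulrDl mul1r lerD// normcM normcV.
  by rewrite ler_pdivrMr// mulrC normc_csinh_le.
by rewrite divfK ?gt_eqF// normc_csinh_le_exp.
Qed.

Lemma csinhN z : csinh (- z) = - csinh z.
Proof. by rewrite /csinh opprK -mulNr opprB. Qed.

Lemma csinhcN z : csinhc (- z) = csinhc z.
Proof. by rewrite /csinhc oppr_eq0 csinhN invrN mulrNN. Qed.

Lemma conjc_csinhc z : (csinhc z)^* = csinhc z^*.
Proof.
rewrite /csinhc conjc_eq0; case: ifP => _; first exact: conjc1.
rewrite /csinh !rmorphM !fmorphV rmorphB rmorph_nat.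
by rewrite /= !conjc_cexp rmorphN.
Qed.

End ComplexExponential.

(** * Complex differentiability of the exponential and of sinh(z)/z *)

Section ComplexDerivability.
Variable R : realType.
Implicit Types z d h : R[i].

Lemma ltc0R (k : R) : (0 < k%:C) = (0 < k).
Proof. exact: (ltcR 0 k). Qed.

Lemma derivable_of_quadratic_bound (f : R[i]^o -> R[i]^o) z d (K : R) :
  (forall h, normc h <= 1 ->
     normc (f (h + z) - f z - d * h) <= K * normc h ^+ 2) ->
  derivable f z 1.
Proof.
move=> fK; apply/cvg_ex; exists d.
(* The bound at h = 1 forces K to be nonnegative; K + 1 below is then a safe denominator. *)
have K0 : 0 <= K.
  have := fK 1; rewrite normc1 expr1n (mulr1 K) => /(_ (lexx _)).
  by move=> h; rewrite (le_trans _ h)// normc_ge0.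
apply/cvgrPdist_le => /= e e0; near=> h.
have h0 : h != 0 by near: h; exact: withinT.
have h1 : `|h| <= 1 by near: h; apply: (@dnbhs0_le _ R[i]^o).
have he : `|h| <= e / (K + 1)%:C.
  by near: h; apply: (@dnbhs0_le _ R[i]^o); rewrite divr_gt0// ltc0R ltr_wpDl.
rewrite -normrN opprB.
have -> : h^-1 *: (f (h *: 1 + z) - f z) - d = h^-1 * (f (h + z) - f z - d * h).
  rewrite /GRing.scale /= mulr1 [RHS]mulrBr [h^-1 * (d * h)]mulrCA.
  by rewrite mulVf// mulr1.
rewrite normrM normrV ?unitfE// ler_pdivrMl ?normr_gt0//.
move: h1 he; rewrite !normr_normc => h1 he.
apply: (@le_trans _ _ ((K * normc h ^+ 2)%:C)).
  by rewrite lecR fK// -lecR.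
have n0 := normc_ge0 h; rewrite ler_pdivlMr ?ltc0R ?ltr_wpDl// in he.
apply: le_trans (ler_wpM2l _ he); last by rewrite ler0c.
by rewrite -!rmorphM lecR; nra.
Unshelve. all: by end_near. Qed.

Lemma derivable_cexp z : derivable (@cexp R : R[i]^o -> R[i]^o) z 1.
Proof.
apply: (@derivable_of_quadratic_bound _ _ (cexp z)
  (normc (cexp z) * (4 * expR 1))) => h h1.
have -> : cexp (h + z) - cexp z - cexp z * h = cexp z * (cexp h - 1 - h).
  by rewrite cexpD; ring.
by rewrite normcM -mulrA ler_wpM2l ?normc_ge0// normc_cexp_sub1B_le.
Qed.

Lemma differentiable_cexp (z : R[i]^o) :
  differentiable (@cexp R : R[i]^o -> R[i]^o) z.
Proof. by apply/derivable1_diffP; exact: derivable_cexp. Qed.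

Lemma differentiable_csinh (z : R[i]^o) :
  differentiable (@csinh R : R[i]^o -> R[i]^o) z.
Proof.
have -> : (@csinh R : R[i]^o -> R[i]^o) =
  2^-1 *: ((@cexp R : R[i]^o -> R[i]^o) -
           ((@cexp R : R[i]^o -> R[i]^o) \o (fun t : R[i]^o => - t : R[i]^o))).
  by apply/funext => t /=; rewrite /csinh mulrC.
apply: differentiableZ; apply: differentiableB; first exact: differentiable_cexp.
apply: differentiable_comp; last exact: differentiable_cexp.
exact: differentiableN.
Qed.

Lemma differentiable_csinhc (z : R[i]^o) :
  differentiable (@csinhc R : R[i]^o -> R[i]^o) z.
Proof.
have [->|z0] := eqVneq z 0.
  apply/derivable1_diffP.
  apply: (@derivable_of_quadratic_bound _ _ 0 (4 * expR 1)) => h h1.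
  rewrite addr0 mul0r subr0 /csinhc eqxx; case: eqP => [->|/eqP h0].
    by rewrite subrr normc0 expr0n mulr0.
  have nh : 0 < normc h.
    rewrite lt_neqAle normc_ge0 andbT eq_sym.
    by apply: contraNneq h0 => /eq0_normc ->.
  have -> : csinh h / h - 1 = (csinh h - h) / h by rewrite mulrBl divff.
  rewrite normcM normcV ler_pdivrMr//.
  by rewrite (le_trans (normc_csinhB_le h1))// exprSr mulrA.
have near_eq : {near z, (fun t : R[i]^o => csinh t * t^-1 : R[i]^o) =1 @csinhc R}.
  (* The ball of radius |z| about z misses 0, so there [csinhc] is the plain quotient. *)
  apply/nbhs_ballP; exists `|z| => /=; first by rewrite normr_gt0.
  move=> t; rewrite -ball_normE /= => zt; rewrite /csinhc ifF//.
  by apply: contraTF zt => /eqP ->; rewrite subr0 ltxx.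
apply/derivable1_diffP.
apply: (@near_eq_derivable _ R[i]^o R[i]^o _ _ z 1 near_eq).
apply/derivable1_diffP; apply: differentiableM.
  exact: differentiable_csinh.
exact: differentiable_Rinv.
Qed.

End ComplexDerivability.

(** * A lower bound for power sums *)

(** Synthetic division of Q by X - y_i: the quotient S satisfies S_l = Q_(l+1) + y_i S_(l+1), and
    the recursion is unrolled until the index passes the degree of S. *)
Lemma coef_prodXsubC_omit (K : comNzRingType) (T : finType) (y : T -> K)
    (i : T) (k : nat) :
  (\prod_(j | j != i) ('X - (y j)%:P))`_k =
  \sum_(t < #|T|) (\prod_j ('X - (y j)%:P))`_(k + t.+1) * y i ^+ t.
Proof.
set Q := \prod_j _; set S := \prod_(j | _) _.
have QE : Q = ('X - (y i)%:P) * S by rewrite /Q (bigD1 i).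
have szQ : size Q = #|T|.+1.
  by rewrite /Q size_prod_XsubC cardE enumT.
have szS : (size S <= #|T|)%N.
  have /monic_neq0 S0 : S \is monic by apply: monic_prod_XsubC.
  move: szQ; rewrite QE size_proper_mul ?lead_coefXsubC ?mul1r ?lead_coef_eq0//.
  by rewrite size_XsubC add2n /= => -[->].
have Srec l : S`_l = Q`_l.+1 + y i * S`_l.+1.
  by rewrite QE mulrBl coefB coefXM coefCM /= subrK.
have : (#|T| <= k + #|T|)%N by rewrite leq_addl.
suff H d l : (#|T| <= l + d)%N ->
    S`_l = \sum_(t < d) Q`_(l + t.+1) * y i ^+ t by apply: H.
elim: d l => [|d IH] l ld.
  by rewrite big_ord0 nth_default// (leq_trans szS)// -(addn0 l).
rewrite Srec big_ord_recl expr0 mulr1 addn1; congr (_ + _).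
rewrite IH ?addSnnS// mulr_sumr; apply: eq_bigr => t _.
by rewrite /bump /= exprS addSnnS mulrCA.
Qed.

Lemma deriv_prod (K : comNzRingType) (T : finType) (P : T -> {poly K}) :
  (\prod_i P i)^`() = \sum_i (P i)^`() * \prod_(j | j != i) P j.
Proof.
have : uniq (index_enum T) by exact: index_enum_uniq.
elim: (index_enum T) => [|i r IH] /=; first by rewrite !big_nil derivC.
move=> /andP[ir /IH {}IH]; rewrite !big_cons derivM IH eqxx /=.
congr (_ * _ + _).
  rewrite big_seq_cond [RHS]big_seq_cond; apply: eq_bigl => j.
  by case: (boolP (j \in r)) => //= jr; apply/esym; apply: contraNneq ir => <-.
rewrite mulr_sumr big_seq [RHS]big_seq; apply: eq_bigr => j jr.
rewrite big_cons ifT; first by rewrite mulrCA.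
by apply: contraNneq ir => ->.
Qed.

(** Newton's identities, read off from the coefficients of X Q': with S_i = Q / (X - y_i) one has X
    Q' = sum_i X S_i = sum_i (Q + y_i S_i). *)
Lemma newton_prodXsubC (K : comNzRingType) (T : finType) (y : T -> K)
    (k : nat) (Q := \prod_j ('X - (y j)%:P)) :
  Q`_k *+ k =
  Q`_k *+ #|T| + \sum_(t < #|T|) Q`_(k + t.+1) * \sum_i y i ^+ t.+1.
Proof.
transitivity (('X * Q^`())`_k).
  by rewrite coefXM coef_deriv; case: k.
rewrite deriv_prod.
under eq_bigr do rewrite derivXsubC mul1r.
transitivity (\sum_i (Q + (y i)%:P * \prod_(j | j != i) ('X - (y j)%:P))`_k).
  rewrite mulr_sumr coef_sum; apply: eq_bigr => i _.
  by rewrite [Q](bigD1 i)//= mulrBl subrK.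
under eq_bigr do rewrite coefD coefCM coef_prodXsubC_omit.
rewrite big_split /= sumr_const cardT -cardE; congr (_ + _).
under eq_bigr do rewrite mulr_sumr.
rewrite exchange_big /=; apply: eq_bigr => t _.
by rewrite mulr_sumr; apply: eq_bigr => i _; rewrite mulrCA -exprS.
Qed.

(* Turan's power sum theorem: by Newton's identities, if all these power sums
   were small, so would be the lower coefficients of the monic polynomial with
   roots [y], which therefore could not vanish at [1]. *)
Lemma exists_large_power_sum (K : numFieldType) (T : finType) (y : T -> K) :
  (exists i, y i = 1) ->
  exists s : 'I_#|T|, #|T|.+1%:R^-1 <= `|\sum_i y i ^+ s.+1|.
Proof.
move=> [i0 yi0]; apply/existsP; rewrite -[X in is_true X]negbK negb_exists.
apply/negP => /forallP small.
set N := #|T| in small *; pose e : K := N.+1%:R^-1.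
pose Q := \prod_j ('X - (y j)%:P).
have e0 : 0 < e by rewrite invr_gt0 ltr0n.
have e1 : e <= 1 by rewrite invf_le1 ?ler1n ?ltr0n.
have psmall t : `|\sum_i y i ^+ (t : 'I_N).+1| <= e.
  have := small t; rewrite real_leNgt ?negbK ?normr_real ?gtr0_real//.
  exact: ltW.
have szQ : size Q = N.+1 by rewrite /Q size_prod_XsubC /N cardE enumT.
have QN : Q`_N = 1.
  have /monicP : Q \is monic by apply: monic_prod_XsubC.
  by rewrite lead_coefE szQ.
(* Descending induction on k. Newton expresses (N - k) Q_k by the N - k terms with k + t + 1 <= N,
   each at most e since the higher coefficients have norm at most 1. *)
have H m : forall k, (k < N)%N -> (N <= k + m)%N -> `|Q`_k| <= e.
  elim: m => [|m IH] k kN; first by rewrite addn0 leqNgt kN.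
  move=> Nkm.
  have Nk0 : (0 : K) < (N - k)%:R by rewrite ltr0n subn_gt0.
  have : Q`_k *+ (N - k) = - \sum_(t < N) Q`_(k + t.+1) * \sum_i y i ^+ t.+1.
    rewrite mulrnBr 1?ltnW// [X in _ - X]newton_prodXsubC opprD addrA.
    by rewrite subrr add0r.
  move/(congr1 Num.norm); rewrite normrMn normrN => QE.
  rewrite -(ler_pM2r Nk0) mulr_natr QE (le_trans (ler_norm_sum _ _ _))//.
  have -> : e * (N - k)%:R = \sum_(t < N | (t < N - k)%N) e.
    rewrite -(big_ord_widen _ (fun=> e)) ?leq_subr//.
    by rewrite sumr_const card_ord mulr_natr.
  rewrite (bigID (fun t : 'I_N => (t < N - k)%N)) /= [X in _ + X]big1 ?addr0.
    apply: ler_sum => t tNk; rewrite normrM -[leRHS]mul1r.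
    apply: ler_pM => //; move: tNk; rewrite ltn_subRL -addnS leq_eqVlt.
    move=> /predU1P[->|tN]; first by rewrite QN normr1.
    by apply: le_trans e1; apply: IH => //; lia.
  move=> t; rewrite -leqNgt => tN.
  by rewrite nth_default ?mul0r ?normr0// szQ; lia.
have : Q.[1] = 0 by rewrite /Q horner_prod (bigD1 i0)//= hornerXsubC yi0 subrr mul0r.
rewrite horner_coef szQ big_ord_recr /= QN expr1n mulr1 => /eqP.
rewrite addrC addr_eq0 => /eqP/(congr1 Num.norm); rewrite normr1 normrN => E.
(* From Q(1) = 0 the leading coefficient 1 is at most the sum of the N lower ones, hence at most N /
   (N + 1), a contradiction. *)
have : 1 <= \sum_(k < N) e.
  rewrite E (le_trans (ler_norm_sum _ _ _))//; apply: ler_sum => k _.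
  by rewrite expr1n mulr1 (H N)// leq_addl.
rewrite sumr_const card_ord -mulr_natr mulrC ler_pdivlMr ?ltr0n// mul1r.
by rewrite ler_nat ltnn.
Qed.

(** * A Paley-Wiener function with a peak at the origin *)

Section DifferentiableBig.
Variables (K : numFieldType) (V : normedModType K) (I : Type) (f : I -> V -> K^o).
Hypothesis df : forall i x, differentiable (f i) x.

Lemma differentiable_big_sum (r : seq I) x :
  differentiable (fun t => \sum_(i <- r) f i t : K^o) x.
Proof.
elim: r => [|i r IH].
  rewrite (_ : (fun _ => _) = cst 0); first exact: differentiable_cst.
  by apply/funext => t; rewrite big_nil.
rewrite (_ : (fun _ => _) = f i \+ (fun t => \sum_(j <- r) f j t : K^o)).
  exact: differentiableD.
by apply/funext => t; rewrite big_cons.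
Qed.

Lemma differentiable_big_prod (r : seq I) x :
  differentiable (fun t => \prod_(i <- r) f i t : K^o) x.
Proof.
elim: r => [|i r IH].
  rewrite (_ : (fun _ => _) = cst 1); first exact: differentiable_cst.
  by apply/funext => t; rewrite big_nil.
rewrite (_ : (fun _ => _) = f i * (fun t => \prod_(j <- r) f j t : K^o)).
  exact: differentiableM.
by apply/funext => t; rewrite big_cons.
Qed.

Lemma differentiable_mulfun (g h : V -> K^o) x :
  differentiable g x -> differentiable h x ->
  differentiable (fun t => g t * h t : K^o) x.
Proof. by move=> dg dh; exact: (@differentiableM _ _ g h). Qed.

Lemma differentiable_expfun (g : V -> K^o) k x :
  differentiable g x -> differentiable (fun t => g t ^+ k : K^o) x.
Proof.
move=> dg; elim: k => [|k IH]; first exact: differentiable_cst.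
rewrite (_ : (fun _ => _) = (fun t => g t * g t ^+ k : K^o)).
  exact: differentiable_mulfun.
by apply/funext => t; rewrite exprS.
Qed.

End DifferentiableBig.

(** * The function [pw] and its sum over the symmetric group *)

Section PaleyWiener.
Variables (R : realType) (n : nat).
Implicit Types (M : R) (m s : nat) (z c : 'rV[R[i]]_n) (x : 'rV[R]_n) (w : 'S_n).

Definition height x : R := \sum_(j < n) (n - j)%:R * x ord0 j.

(** The l1 norms replace the Euclidean ones in the estimates because they fit products over
    coordinates and partial sums. *)
Definition l1norm x : R := \sum_(j < n) `|x ord0 j|.

Definition l1normC z : R := \sum_(j < n) normc (z ord0 j).

Definition pw M m z : R[i] :=
  cexp (\sum_(j < n) (M * (n - j)%:R)%:C * z ord0 j) *
  \prod_(j < n) csinhc (z ord0 j) ^+ m.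

Definition pw_sum M m s c z : R[i] :=
  \sum_w pw M m (col_perm w z - c) ^+ s.

Definition neg_conj z : 'rV[R[i]]_n := - map_mx (@conjc R) z.

Lemma pw0 M m : pw M m 0 = 1.
Proof.
rewrite /pw big1; last by move=> j _; rewrite mxE mulr0.
rewrite cexp0 mul1r big1// => j _.
by rewrite mxE /csinhc eqxx expr1n.
Qed.

Lemma conjc_sum (I : Type) (r : seq I) (f : I -> R[i]) :
  (\sum_(i <- r) f i)^* = \sum_(i <- r) (f i)^*.
Proof. exact: rmorph_sum. Qed.

Lemma conjcX (a : R[i]) k : (a ^+ k)^* = a^* ^+ k.
Proof. exact: rmorphXn. Qed.

(** Passing from conj z to - conj z flips the sign of M in the exponential and leaves the even
    function [csinhc] unchanged. *)
Lemma conjc_pw M m z : (pw M m z)^* = pw (- M) m (neg_conj z).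
Proof.
rewrite /pw rmorphM rmorph_prod /= conjc_cexp rmorph_sum /=; congr (cexp _ * _).
  apply: eq_bigr => j _; rewrite !mxE; case: (z ord0 j) => a b.
  by apply/eqP; rewrite eq_complex /=; apply/andP; split; apply/eqP; ring.
by apply: eq_bigr => j _; rewrite rmorphXn /= conjc_csinhc !mxE csinhcN.
Qed.

(** Hence conj(g(- conj z)), for g = [pw_sum M m s c], is again a [pw_sum], with parameters - M and
    [neg_conj c]; its differentiability and invariance come for free. *)
Lemma conjc_pw_sum M m s c z :
  (pw_sum M m s c z)^* = pw_sum (- M) m s (neg_conj c) (neg_conj z).
Proof.
rewrite {1}/pw_sum conjc_sum; apply: eq_bigr => w _.
rewrite conjcX conjc_pw; congr (pw _ _ _ ^+ _).
apply/rowP => j; rewrite !mxE; case: (z _ _) => a b; case: (c _ _) => a' b'.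
by apply/eqP; rewrite eq_complex /= !opprD !eqxx.
Qed.

Lemma pw_sum_perm M m s c z w :
  pw_sum M m s c (col_perm w z) = pw_sum M m s c z.
Proof.
rewrite /pw_sum [RHS](reindex_inj (mulIg w)); apply: eq_bigr => v _.
rewrite (_ : col_perm v (col_perm w z) = col_perm (v * w)%g z)//.
by apply/rowP => j; rewrite !mxE permM.
Qed.

Lemma normr_coord_le (z : C0 R n) (j : 'I_n) : `|C0val z ord0 j| <= `|z|.
Proof.
suff : `|C0val z ord0 j| <= mx_norm (C0val z) by [].
rewrite mx_normE -[leLHS]nngE num_le.
exact: (le_bigmax _ (fun i => `|C0val z i.1 i.2|%:nng) (ord0, j)).
Qed.

(** A coordinate is a linear form, continuous because it is dominated by the sup norm. *)
Lemma differentiable_coord_C0 (j : 'I_n) (z : C0 R n) :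
  differentiable (fun t : C0 R n => C0val t ord0 j : R[i]^o) z.
Proof.
have lin : linear (fun t : C0 R n => C0val t ord0 j : R[i]^o).
  by move=> a u v; rewrite /= !mxE.
pose L := GRing.isLinear.Build _ _ _ _ _ lin.
pose F : {linear C0 R n -> R[i]^o} :=
  HB.pack (fun t : C0 R n => C0val t ord0 j : R[i]^o) L.
apply: (@linear_differentiable _ _ _ F) => y U.
move=> /nbhs_ballP[e e0 eU].
apply/nbhs_ballP; exists e => // t ty; apply: eU; move: ty.
rewrite -!ball_normE /=; apply: le_lt_trans.
have -> : C0val y ord0 j - C0val t ord0 j = C0val (y - t) ord0 j.
  by rewrite !mxE.
exact: normr_coord_le.
Qed.

Lemma differentiable_pw_sum M m s c (z : C0 R n) :
  differentiable (fun t : C0 R n => pw_sum M m s c t : R[i]^o) z.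
Proof.
have coord w j t : differentiable
    (fun t : C0 R n => (col_perm w t - c) ord0 j : R[i]^o) t.
  rewrite (_ : (fun _ => _) =
    (fun t : C0 R n => C0val t ord0 (w j) : R[i]^o) - cst (c ord0 j)).
    apply: differentiableB; first exact: differentiable_coord_C0.
    exact: differentiable_cst.
  by apply/funext => u; rewrite !mxE.
apply: differentiable_big_sum => w {}z.
apply: differentiable_expfun; apply: differentiable_mulfun.
  apply: (@differentiable_comp _ _ _ _
    (fun t : C0 R n => \sum_(j < n) (M * (n - j)%:R)%:C *
       (col_perm w t - c) ord0 j : R[i]^o) (@cexp R : R[i]^o -> R[i]^o)).
    apply: differentiable_big_sum => j {}z; apply: differentiable_mulfun.
      exact: differentiable_cst.
    exact: coord.
  exact: differentiable_cexp.
apply: differentiable_big_prod => j {}z; apply: differentiable_expfun.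
apply: (@differentiable_comp _ _ _ _
  (fun t : C0 R n => (col_perm w t - c) ord0 j : R[i]^o)
  (@csinhc R : R[i]^o -> R[i]^o)) => //.
exact: differentiable_csinhc.
Qed.

(** Turns decay in each coordinate separately into decay in the l1 norm. *)
Lemma sum_le_prod (I : Type) (r : seq I) (a : I -> R) :
  (forall i, 0 <= a i) -> 1 + \sum_(i <- r) a i <= \prod_(i <- r) (1 + a i).
Proof.
move=> a0; elim: r => [|i r IH]; first by rewrite !big_nil addr0.
rewrite !big_cons; have := a0 i.
have : 0 <= \sum_(j <- r) a j by apply: sumr_ge0.
by nra.
Qed.

Lemma enormC_ge0 z : 0 <= enormC z.
Proof. exact: sqrtr_ge0. Qed.

Lemma sum_sqr_le (I : Type) (r : seq I) (a : I -> R) :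
  (forall i, 0 <= a i) -> \sum_(i <- r) a i ^+ 2 <= (\sum_(i <- r) a i) ^+ 2.
Proof.
move=> a0; elim: r => [|i r IH]; first by rewrite !big_nil expr0n.
rewrite !big_cons; have := a0 i.
have : 0 <= \sum_(j <- r) a j by apply: sumr_ge0.
by nra.
Qed.

Lemma l1normC_ge0 z : 0 <= l1normC z.
Proof. by apply: sumr_ge0 => j _; exact: normc_ge0. Qed.

Lemma enormC_le_l1normC z : enormC z <= l1normC z.
Proof.
have s0 := l1normC_ge0 z.
rewrite -(ler_pXn2r (n := 2)) ?nnegrE ?enormC_ge0// sqr_sqrtr.
  by apply: sum_sqr_le => j; exact: normc_ge0.
by apply: sumr_ge0 => j _; exact: sqr_ge0.
Qed.

Lemma enormR_le_l1norm x : enormR x <= l1norm x.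
Proof.
have s0 : 0 <= l1norm x by apply: sumr_ge0.
rewrite -(ler_pXn2r (n := 2)) ?nnegrE ?sqrtr_ge0// sqr_sqrtr.
  rewrite (le_trans _ (sum_sqr_le _ _))//.
  by apply: ler_sum => j _; rewrite real_normK ?num_real.
by apply: sumr_ge0 => j _; exact: sqr_ge0.
Qed.

Lemma l1norm_le_enormR x : l1norm x <= n%:R * enormR x.
Proof.
have -> : n%:R * enormR x = \sum_(j < n) enormR x.
  by rewrite sumr_const card_ord mulr_natl.
apply: ler_sum => j _.
rewrite -(ler_pXn2r (n := 2)) ?nnegrE ?sqrtr_ge0// sqr_sqrtr.
  rewrite real_normK ?num_real// (bigD1 j)//= lerDl.
  by apply: sumr_ge0 => k _; exact: sqr_ge0.
by apply: sumr_ge0 => k _; exact: sqr_ge0.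
Qed.

Lemma abs_height_le x : `|height x| <= n%:R * l1norm x.
Proof.
rewrite (le_trans (ler_norm_sum _ _ _))// mulr_sumr; apply: ler_sum => j _.
by rewrite normrM normr_nat ler_wpM2r// ler_nat leq_subr.
Qed.

Lemma normc_sum (I : Type) (r : seq I) (f : I -> R[i]) :
  normc (\sum_(i <- r) f i) <= \sum_(i <- r) normc (f i).
Proof.
elim: r => [|i r IH]; first by rewrite !big_nil normc0.
by rewrite !big_cons (le_trans (le_normcD _ _))// lerD2l.
Qed.

Lemma normc_prod (I : Type) (r : seq I) (f : I -> R[i]) :
  normc (\prod_(i <- r) f i) = \prod_(i <- r) normc (f i).
Proof. by apply: big_morph; [exact: normcM|exact: normc1]. Qed.

Lemma normcX (a : R[i]) k : normc (a ^+ k) = normc a ^+ k.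
Proof. by elim: k => [|k IH]; rewrite ?normc1// !exprS normcM IH. Qed.

(** The exponential has modulus exactly e^(M height(Re z)); each factor [csinhc] contributes
    [normc_csinhc_le], raised to the power m. *)
Lemma normc_pw_le M m z :
  normc (pw M m z) * (1 + l1normC z) ^+ m <=
  2 ^+ (n * m) *
    expR (M * height (Re_vec z) + m%:R * l1norm (Re_vec z)).
Proof.
rewrite normcM normc_cexp normc_prod -mulrA expRD [leRHS]mulrCA.
have -> : complex.Re (\sum_(j < n) (M * (n - j)%:R)%:C * z ord0 j) =
    M * height (Re_vec z).
  rewrite raddf_sum mulr_sumr; apply: eq_bigr => j _.
  by rewrite mulrA !mxE; case: (z ord0 j) => a b /=; rewrite mul0r subr0.
rewrite ler_wpM2l ?expR_ge0//.
rewrite expRM_natl exprM -exprMn.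
under eq_bigr do rewrite normcX.
rewrite prodrXl -exprMn; apply: lerXn2r; rewrite ?nnegrE.
- rewrite mulr_ge0 ?addr_ge0 ?l1normC_ge0//.
  by apply: prodr_ge0 => j _; exact: normc_ge0.
- by rewrite mulr_ge0 ?exprn_ge0 ?expR_ge0.
apply: (@le_trans _ _ (\prod_(j < n) (normc (csinhc (z ord0 j)) *
                                      (1 + normc (z ord0 j))))).
  rewrite big_split /= ler_wpM2l//.
    by apply: prodr_ge0 => j _; exact: normc_ge0.
  by apply: sum_le_prod => j; exact: normc_ge0.
apply: (@le_trans _ _ (\prod_(j < n) (2 * expR `|complex.Re (z ord0 j)|))).
  apply: ler_prod => j _; rewrite mulr_ge0 ?addr_ge0 ?normc_ge0//=.
  exact: normc_csinhc_le.
rewrite big_split /= prodr_const card_ord expR_sum.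
apply: ler_wpM2l; rewrite ?exprn_ge0//.
by apply: ler_prod => j _; rewrite mxE expR_ge0 lexx.
Qed.

End PaleyWiener.

(** * Majorization and orbit distances *)

Section Majorization.
Variables (R : realType) (n : nat).
Implicit Types (x u : 'rV[R]_n) (v w : 'S_n).

(** With partial sums X_k >= 0, |x_j| = |X_(j+1) - X_j| <= X_(j+1) + X_j, while [height x] is the
    sum of X_1, ..., X_n. *)
Lemma l1norm_le_height x :
  (forall k, (1 <= k <= n)%N -> 0 <= \sum_(j < n | (j < k)%N) x ord0 j) ->
  l1norm x <= 2 * height x.
Proof.
pose X k := \sum_(j < n | (j < k)%N) x ord0 j => X_ge0.
have X0 : X 0%N = 0 by rewrite /X big1// => j; rewrite ltn0.
have {}X_ge0 k : (k <= n)%N -> 0 <= X k.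
  by case: k => [|k] kn; [rewrite X0|exact: X_ge0].
have heightE : height x = \sum_(k < n) X k.+1.
  rewrite /X (exchange_big_dep xpredT)//=; apply: eq_bigr => j _.
  rewrite (eq_bigl (fun k : 'I_n => (j <= k)%N))//.
  rewrite -(big_mkord (fun k => (j <= k)%N) (fun=> x ord0 j)).
  by rewrite -(big_nat_widenl j 0 n xpredT)// sumr_const_nat mulr_natl.
have xE (j : 'I_n) : x ord0 j = X j.+1 - X j.
  rewrite /X (bigD1 j)//=.
  rewrite (eq_bigl (fun k : 'I_n => (k < j)%N)) ?addrK// => k.
  by rewrite ltnS -val_eqE/= ltn_neqAle andbC.
(* The two sums differ by X_n - X_0, where X_0 = 0 and X_n >= 0. *)
have XS : \sum_(j < n) X j <= \sum_(j < n) X j.+1.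
  have : \sum_(j < n) X j + X n = X 0%N + \sum_(j < n) X j.+1.
    by rewrite -(big_ord_recr n (fun k => X k)) big_ord_recl.
  by rewrite X0 add0r => <-; rewrite lerDl X_ge0.
rewrite heightE mulr2n mulrDl mul1r (le_trans _ (lerD XS (lexx _)))//.
rewrite -big_split /=; apply: ler_sum => j _; rewrite xE addrC.
rewrite (le_trans (ler_normB _ _))//.
by rewrite !ger0_norm ?X_ge0// ltnW.
Qed.

Lemma exists_sorting_perm u :
  exists w : 'S_n, forall i j : 'I_n, (i <= j)%N -> u ord0 (w j) <= u ord0 (w i).
Proof.
pose r := [rel i j : 'I_n | u ord0 j <= u ord0 i].
have r_tr : transitive r by move=> j i k /= ji kj; exact: le_trans ji.
have r_tot : total r by move=> i j /=; exact: le_total.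
(* Indices are sorted rather than values, so that the permutation is read off the list. *)
pose s := sort r (enum 'I_n).
have szs : size s = n by rewrite size_sort size_enum_ord.
have us : uniq s by rewrite sort_uniq enum_uniq.
have f_inj : injective (fun i : 'I_n => nth i s i).
  move=> i j; rewrite (set_nth_default i) ?szs// => /eqP.
  by rewrite nth_uniq ?szs// => /eqP /val_inj.
exists (perm f_inj) => i j ij; rewrite !permE.
rewrite (set_nth_default i j) ?szs//.
by apply: (sorted_leq_nth r_tr _ _ (sort_sorted r_tot _));
   rewrite ?inE ?szs//; move=> k /=.
Qed.

(** Threshold argument: let t be the smallest of the k largest entries. Subtracting t, any k entries
    sum to at most the sum of all positive parts of u_j - t. That sum is invariant under
    permutations, and the k largest entries attain it. *)
Lemma partial_sum_le_sorted u w :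
  (forall i j : 'I_n, (i <= j)%N -> u ord0 (w j) <= u ord0 (w i)) ->
  forall v k, (k <= n)%N ->
  \sum_(j < n | (j < k)%N) u ord0 (v j) <= \sum_(j < n | (j < k)%N) u ord0 (w j).
Proof.
move=> w_sorted v [|k] kn; first by rewrite !big1.
pose t := u ord0 (w (Ordinal kn)); pose p (a : R) := Num.max 0 (a - t).
have sumE (f : 'I_n -> R) : \sum_(j < n | (j < k.+1)%N) f j =
    \sum_(j < n | (j < k.+1)%N) (f j - t) + t *+ #|[pred j : 'I_n | (j < k.+1)%N]|.
  by rewrite -sumr_const -big_split /=; apply: eq_bigr => j _; rewrite subrK.
rewrite (sumE (fun j => u ord0 (v j))) (sumE (fun j => u ord0 (w j))) lerD2r.
have le_p a : a - t <= p a by rewrite /p le_max lexx orbT.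
have p_ge0 a : 0 <= p a by rewrite /p le_max lexx.
apply: (@le_trans _ _ (\sum_(j < n) p (u ord0 (v j)))).
  rewrite [leRHS](bigID (fun j : 'I_n => (j < k.+1)%N)) /= -[leLHS]addr0 lerD//.
    exact: ler_sum.
  exact: sumr_ge0.
have -> : \sum_(j < n) p (u ord0 (v j)) = \sum_(j < n) p (u ord0 (w j)).
  have E (f : 'S_n) : \sum_(j < n) p (u ord0 (f j)) = \sum_(j < n) p (u ord0 j).
    by rewrite [RHS](reindex_inj (@perm_inj _ f)).
  by rewrite !E.
rewrite (bigID (fun j : 'I_n => (j < k.+1)%N)) /= [X in _ + X]big1 ?addr0.
  apply: ler_sum => j jk; rewrite /p ge_max lexx andbT subr_ge0.
  by apply: w_sorted.
move=> j; rewrite -leqNgt => kj; apply/max_idPl; rewrite subr_le0.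
by apply: w_sorted => /=; exact: ltnW.
Qed.

End Majorization.

Section OrbitDistance.
Variables (R : realType) (V : zmodType) (n : nat) (N : 'rV[V]_n -> R).

Lemma orbit_dist_ge0 (z z' : 'rV[V]_n) :
  (forall t, 0 <= N t) -> 0 <= orbit_dist N z z'.
Proof.
move=> N0; apply: (big_ind (fun a => 0 <= a)) => // a b a0 b0.
by rewrite le_min a0.
Qed.

Lemma orbit_dist_le (z z' : 'rV[V]_n) (v w : 'S_n) :
  orbit_dist N z z' <= N (col_perm v z - col_perm w z').
Proof. exact: (bigmin_le _ (v, w)). Qed.

End OrbitDistance.

(** * The theorem *)

Section Estimates.
Variables (R : realType) (n : nat).
Implicit Types (A M : R) (m s : nat) (z c : 'rV[R[i]]_n) (w : 'S_n).

Lemma normc_real (a : R) : normc a%:C = `|a|.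
Proof. by rewrite /= expr0n addr0 sqrtr_sqr. Qed.

Lemma l1normN (x : 'rV[R]_n) : l1norm (- x) = l1norm x.
Proof. by apply: eq_bigr => j _; rewrite mxE normrN. Qed.

Lemma l1normCN z : l1normC (- z) = l1normC z.
Proof. by apply: eq_bigr => j _; rewrite mxE normcN. Qed.

Lemma heightN (x : 'rV[R]_n) : height (- x) = - height x.
Proof. by rewrite /height -sumrN; apply: eq_bigr => j _; rewrite mxE mulrN. Qed.

Lemma Re_vecB z c : Re_vec (z - c) = Re_vec z - Re_vec c.
Proof.
apply/rowP => j; rewrite !mxE.
by case: (z _ _) => a b; case: (c _ _) => a' b'.
Qed.

Lemma Re_vec_perm w z : Re_vec (col_perm w z) = col_perm w (Re_vec z).
Proof. by apply/rowP => j; rewrite !mxE. Qed.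

Lemma l1norm_perm w (x : 'rV[R]_n) : l1norm (col_perm w x) = l1norm x.
Proof.
rewrite /l1norm [RHS](reindex_inj (@perm_inj _ w)) /=.
by apply: eq_bigr => j _; rewrite mxE.
Qed.

Lemma l1normC_perm w z : l1normC (col_perm w z) = l1normC z.
Proof.
rewrite /l1normC [RHS](reindex_inj (@perm_inj _ w)) /=.
by apply: eq_bigr => j _; rewrite mxE.
Qed.

Lemma l1normB_le (x y : 'rV[R]_n) : l1norm (x - y) <= l1norm x + l1norm y.
Proof.
rewrite -big_split /=; apply: ler_sum => j _; rewrite !mxE.
exact: ler_normB.
Qed.

Lemma l1normC_le_sub z c : l1normC z <= l1normC (z - c) + l1normC c.
Proof.
rewrite -big_split /=; apply: ler_sum => j _; rewrite !mxE.
by rewrite -{1}(subrK (c ord0 j) (z ord0 j)) le_normcD.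
Qed.

Lemma l1norm_ge0 (x : 'rV[R]_n) : 0 <= l1norm x.
Proof. exact: sumr_ge0. Qed.

(** Since a^A <= a^m <= b^m, decay of integer order m in b yields decay of real order A in the
    smaller quantity a. *)
Lemma le_mul_powRN A m (a b p q : R) : 0 <= A <= m%:R -> 1 <= a -> a <= b ->
  0 <= p -> p * b ^+ m <= q -> p <= q * a `^ (- A).
Proof.
move=> /andP[A0 Am] a1 ab p0 pq.
have a0 : 0 < a := lt_le_trans ltr01 a1.
have b0 : 0 <= b := le_trans (ltW a0) ab.
rewrite powRN ler_pdivlMr ?powR_gt0//; apply: le_trans pq.
rewrite ler_wpM2l// -powR_mulrn//.
apply: (@le_trans _ _ (a `^ m%:R)); first exact: ler_powR.
by apply: ge0_ler_powR => //; rewrite nnegrE// ltW.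
Qed.

(** The choice M = 2 (m + A) makes M height(Re z) at most - (m + A) times the l1 norm of Re z. The
    part with m cancels the growth of the sinh factors. *)
Lemma normc_pw_decay A m z : 0 <= A ->
  (forall k, (1 <= k <= n)%N ->
     0 <= \sum_(j < n | (j < k)%N) (- Re_vec z) ord0 j) ->
  normc (pw (2 * (m%:R + A)) m z) * (1 + l1normC z) ^+ m <=
  2 ^+ (n * m) * expR (- (A * l1norm (Re_vec z))).
Proof.
move=> A0 /l1norm_le_height; rewrite l1normN heightN => hz.
rewrite (le_trans (normc_pw_le _ _ _))// ler_wpM2l ?exprn_ge0// ler_expR.
have m0 : 0 <= (m%:R : R) by [].
by nra.
Qed.

(** A bound for all z, for the Paley-Wiener condition, whose constant may depend on c. The shift by
    c is absorbed by 1 + |z| <= (1 + |w z - c|) (1 + |c|) in l1 norms. *)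
Lemma normc_pw_growth A M m c w z : 0 <= A <= m%:R ->
  normc (pw M m (col_perm w z - c)) <=
  2 ^+ (n * m) * (1 + l1normC c) ^+ m *
    expR ((`|M| * n%:R + m%:R) * l1norm (Re_vec c)) *
    expR ((`|M| * n%:R + m%:R) * n%:R * enormR (Re_vec z)) *
    (1 + enormC z) `^ (- A).
Proof.
move=> Am; set L := `|M| * _ + _.
have L0 : 0 <= L by rewrite addr_ge0// mulr_ge0.
apply: (@le_mul_powRN _ m _ (1 + l1normC z)) => //.
- by rewrite lerDl enormC_ge0.
- by rewrite lerD2l enormC_le_l1normC.
- exact: normc_ge0.
set zeta := col_perm w z - c.
have c0 := l1normC_ge0 c; have zeta0 := l1normC_ge0 zeta.
have z0 := l1normC_ge0 z.
have le1 : (1 + l1normC z) ^+ m <=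
    (1 + l1normC zeta) ^+ m * (1 + l1normC c) ^+ m.
  rewrite -exprMn; apply: lerXn2r; rewrite ?nnegrE ?mulr_ge0 ?addr_ge0//.
  have := l1normC_le_sub (col_perm w z) c; rewrite l1normC_perm -/zeta.
  by nra.
rewrite (le_trans (ler_wpM2l (normc_ge0 _) le1))// mulrA.
set e1 := expR (L * _); set e2 := expR (_ * enormR _).
have -> : 2 ^+ (n * m) * (1 + l1normC c) ^+ m * e1 * e2 =
    2 ^+ (n * m) * (e1 * e2) * (1 + l1normC c) ^+ m by ring.
rewrite ler_wpM2r ?exprn_ge0 ?addr_ge0// (le_trans (normc_pw_le _ _ _))//.
rewrite ler_wpM2l ?exprn_ge0// -expRD ler_expR.
apply: (@le_trans _ _ (L * l1norm (Re_vec zeta))).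
  rewrite [leRHS]mulrDl lerD2r (le_trans (ler_norm _))// normrM -mulrA.
  by rewrite ler_wpM2l// abs_height_le.
rewrite -mulrA -mulrDr ler_wpM2l// Re_vecB Re_vec_perm.
rewrite (le_trans (l1normB_le _ _))// l1norm_perm addrC lerD2l.
exact: l1norm_le_enormR.
Qed.

(** As K >= 1 and B <= 1, (K B)^s <= K^(n!) B. The bound is uniform in s, which will depend on the
    base point. *)
Lemma normc_pw_sum_le M m s c z (K B : R) :
  (forall w, normc (pw M m (col_perm w z - c)) <= K * B) ->
  1 <= K -> 0 <= B <= 1 -> (0 < s <= #|'S_n|)%N ->
  normc (pw_sum M m s c z) <= #|'S_n|%:R * K ^+ #|'S_n| * B.
Proof.
move=> pwKB K1 /andP[B0 B1] /andP[s0 sN].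
rewrite (le_trans (normc_sum _ _))//.
have -> : #|'S_n|%:R * K ^+ #|'S_n| * B = \sum_(w : 'S_n) (K ^+ #|'S_n| * B).
  by rewrite sumr_const -mulrA mulr_natl.
apply: ler_sum => w _; rewrite normcX.
apply: (@le_trans _ _ ((K * B) ^+ s)).
  by apply: lerXn2r; rewrite ?nnegrE ?normc_ge0 ?mulr_ge0// (le_trans ler01).
rewrite exprMn; apply: ler_pM; rewrite ?exprn_ge0 ?(le_trans ler01 K1)//.
  exact: ler_weXn2l.
by rewrite -[leRHS]expr1 ler_wiXn2l.
Qed.

Lemma neg_conj_fixed_perm z :
  neg_conj_fixed z -> exists w, col_perm w z = neg_conj z.
Proof.
move=> Hz; have : W_orbit (neg_conj z) (neg_conj z).
  by exists 1%g => //; rewrite col_perm1.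
by rewrite -Hz => -[w _ <-]; exists w.
Qed.

(** Here - conj z lies in the orbit of z, so by invariance the second factor may be evaluated there,
    where it is the conjugate of the first. *)
Lemma pw_sum_mul_conj M m s c z : neg_conj_fixed z ->
  pw_sum M m s c z * pw_sum (- M) m s (neg_conj c) z =
  (normc (pw_sum M m s c z) ^+ 2)%:C.
Proof.
move=> /neg_conj_fixed_perm[w wz].
rewrite -(pw_sum_perm (- M) m s (neg_conj c) z w) wz -conjc_pw_sum.
by rewrite -sqr_normc normr_normc rmorphXn.
Qed.

End Estimates.

Theorem theorem9 (R : realType) (n : nat) (A : R) (n_ge1 : (1 <= n)%N)
    (A_gt0 : 0 < A) :
  exists2 r : R, 0 < r &
  exists c1 c2 c3 c4 : R, [/\ 0 < c1, 0 < c2, 0 < c3 & 0 < c4] /\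
  forall z0 : C0 R n, neg_conj_fixed z0 ->
  exists h : C0 R n -> R[i],
    [/\ entire_mod_W h,
        exists2 c : R, 0 < c & forall z : C0 R n,
          normc (h z) <=
            c * (expR (r * enormR (Re_vec z)) * (1 + enormC z) `^ (- A)),
        forall z : C0 R n, neg_conj_fixed z -> majorized (Re_vec z) (Re_vec z0) ->
          0 <= h z /\ normc (h z) <= c1 * (1 + distC z0 z) `^ (- A),
        forall z : C0 R n, neg_conj_fixed z -> majorized (Re_vec z) (Re_vec z0) ->
          0 <= h z /\
          normc (h z) <= c2 * expR (- (A * distR (Re_vec z0) (Re_vec z))) &
        normc (h z0) <= c3 /\ 1 <= c4%:C * h z0].
Proof.
pose m := Num.bound A; pose N := #|'S_n|.
have Am : 0 <= A <= m%:R by rewrite ltW//= ltW// archi_boundP// ltW.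
have N_gt0 : (0 < N)%N by apply/card_gt0P; exists 1%g.
pose M : R := 2 * (m%:R + A); pose K : R := 2 ^+ (n * m).
have K_ge1 : 1 <= K by rewrite exprn_ege1// ler1n.
have K_gt0 : 0 < K := lt_le_trans ltr01 K_ge1.
pose L := (`|M| * n%:R + m%:R) * n%:R.
have L_ge0 : 0 <= L by rewrite mulr_ge0// addr_ge0// mulr_ge0.
(* The square of the constant in [normc_pw_sum_le], since h = |g|^2. Like M, K and L it does not
   involve [z0]. *)
pose D := (N%:R * K ^+ N) ^+ 2.
have D_gt0 : 0 < D by rewrite exprn_gt0// mulr_gt0 ?exprn_gt0// ltr0n.
pose q : R := N.+1%:R^-1.
have q_gt0 : 0 < q by rewrite invr_gt0 ltr0n.
(* Each of the two factors of h grows at rate at most N L; the 1 makes positivity immediate. *)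
exists (2 * N%:R * L + 1).
  by rewrite ltr_wpDl// mulr_ge0// mulr_ge0.
exists D, D, D, (q ^- 2); split; first by rewrite !D_gt0 invr_gt0 exprn_gt0.
move=> z0 z0_fixed.
have [w0 w0_sorted] := exists_sorting_perm (Re_vec z0).
pose c := col_perm w0 z0.
(* At z0 the summand of index [w0] is pw(0) = 1, as the power sum theorem requires. *)
have [s s_large] : exists s : 'I_N,
    N.+1%:R^-1 <= `|pw_sum M m s.+1 c z0|.
  apply: exists_large_power_sum; exists w0.
  by rewrite subrr pw0.
have sN : (0 < s.+1 <= N)%N by rewrite ltn_ord.
exists (fun z : C0 R n =>
  pw_sum M m s.+1 c z * pw_sum (- M) m s.+1 (neg_conj c) z).
have hE (z : C0 R n) : neg_conj_fixed z ->
    pw_sum M m s.+1 c z * pw_sum (- M) m s.+1 (neg_conj c) z =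
    (normc (pw_sum M m s.+1 c z) ^+ 2)%:C by exact: pw_sum_mul_conj.
have sqr_le (z : C0 R n) (B : R) : neg_conj_fixed z -> 0 <= B <= 1 ->
    (forall w, normc (pw M m (col_perm w z - c)) <= K * B) ->
    0 <= pw_sum M m s.+1 c z * pw_sum (- M) m s.+1 (neg_conj c) z /\
    normc (pw_sum M m s.+1 c z * pw_sum (- M) m s.+1 (neg_conj c) z) <= D * B.
  move=> z_fixed B01 pwB; rewrite hE//.
  have /andP[B0 B1] := B01.
  have := normc_pw_sum_le pwB K_ge1 B01 sN.
  have := normc_ge0 (pw_sum M m s.+1 c z).
  set y := normc (pw_sum _ _ _ _ _) => y0 yB.
  rewrite ler0c sqr_ge0; split=> //.
  rewrite normc_real ger0_norm ?sqr_ge0//.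
  apply: (@le_trans _ _ ((N%:R * K ^+ N * B) ^+ 2)).
    by apply: lerXn2r; rewrite ?nnegrE// (le_trans y0).
  rewrite exprMn ler_wpM2l ?(ltW D_gt0)//.
  by rewrite expr2 ler_piMr.
have decay (z : C0 R n) w : majorized (Re_vec z) (Re_vec z0) ->
    normc (pw M m (col_perm w z - c)) * (1 + l1normC (col_perm w z - c)) ^+ m
      <= K * expR (- (A * l1norm (Re_vec (col_perm w z - c)))).
  move=> [w1 maj]; apply: normc_pw_decay; first exact: ltW.
  move=> k /andP[k1 kn].
  (* Majorization compares with the ordering [w1] of Re z0; the decreasing ordering [w0] has partial
     sums at least as large. *)
  rewrite (eq_bigr (fun j => Re_vec z0 ord0 (w0 j) - Re_vec z ord0 (w j))).
    rewrite sumrB subr_ge0 (le_trans (maj w k _)) ?k1//.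
    exact: partial_sum_le_sorted.
  by move=> j _; rewrite Re_vecB !Re_vec_perm !mxE opprB.
have distC_bound (z : C0 R n) w : majorized (Re_vec z) (Re_vec z0) ->
    normc (pw M m (col_perm w z - c)) <= K * (1 + distC z0 z) `^ (- A).
  move=> maj.
  have d_ge0 : 0 <= distC z0 z by apply: orbit_dist_ge0 => t; exact: enormC_ge0.
  (* This bound keeps the polynomial part of [decay] and drops the exponential; [distR_bound] does
     the opposite. *)
  apply: (@le_mul_powRN _ A m _ (1 + l1normC (col_perm w z - c))) => //.
  - by rewrite lerDl.
  - rewrite lerD2l -l1normCN opprB.
    by rewrite (le_trans (orbit_dist_le _ _ _ w0 w))// enormC_le_l1normC.
  - exact: normc_ge0.
  rewrite (le_trans (decay z w maj))// ler_piMr ?(ltW K_gt0)//.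
  by rewrite expR_le1 oppr_le0 mulr_ge0 ?(ltW A_gt0) ?l1norm_ge0.
have distR_bound (z : C0 R n) w : majorized (Re_vec z) (Re_vec z0) ->
    normc (pw M m (col_perm w z - c)) <=
    K * expR (- (A * distR (Re_vec z0) (Re_vec z))).
  move=> maj.
  apply: (@le_trans _ _
    (K * expR (- (A * l1norm (Re_vec (col_perm w z - c)))))).
    apply: le_trans (decay z w maj); rewrite ler_peMr ?normc_ge0//.
    by rewrite exprn_ege1// lerDl l1normC_ge0.
  rewrite ler_wpM2l ?(ltW K_gt0)// ler_expR lerN2 ler_wpM2l ?(ltW A_gt0)//.
  rewrite (le_trans (orbit_dist_le _ _ _ w0 w))//.
  rewrite (le_trans (enormR_le_l1norm _))//.
  by rewrite -l1normN opprB Re_vecB !Re_vec_perm.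
have powR_le1 (a : R) : 0 <= a -> 0 <= (1 + a) `^ (- A) <= 1.
  move=> a0; rewrite powR_ge0 powRN invf_le1 ?powR_gt0 ?ltr_pwDl//.
  by rewrite -[leLHS](powRr0 (1 + a)) ler_powR ?lerDl// ltW.
have maj0 : majorized (Re_vec z0) (Re_vec z0).
  exists w0 => w' k /andP[_ kn]; exact: partial_sum_le_sorted.
split.
- split=> [z|w z].
    by apply: differentiable_mulfun; exact: differentiable_pw_sum.
  by rewrite /= !pw_sum_perm.
- pose e (c' : 'rV[R[i]]_n) : R := K * (1 + l1normC c') ^+ m *
    expR ((`|M| * n%:R + m%:R) * l1norm (Re_vec c')).
  have e_ge1 c' : 1 <= e c'.
    have E1 : 1 <= expR ((`|M| * n%:R + m%:R) * l1norm (Re_vec c')).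
      by rewrite -[leLHS]expR0 ler_expR mulr_ge0 ?l1norm_ge0.
    rewrite mulr_ege1// mulr_ege1// exprn_ege1// lerDl; exact: l1normC_ge0.
  (* Stated for both factors of h, which have parameters M, c and - M, [neg_conj c]. *)
  have growth M' c' (z : C0 R n) : `|M'| = `|M| ->
      normc (pw_sum M' m s.+1 c' z) <= N%:R * e c' ^+ N *
        expR (N%:R * L * enormR (Re_vec z)) * (1 + enormC z) `^ (- A).
    move=> M'E.
    have -> : N%:R * e c' ^+ N * expR (N%:R * L * enormR (Re_vec z)) =
        N%:R * (e c' * expR (L * enormR (Re_vec z))) ^+ N.
      have -> : expR (N%:R * L * enormR (Re_vec z)) =
          expR (L * enormR (Re_vec z)) ^+ N by rewrite -expRM_natl -(mulrA N%:R L).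
      by rewrite (exprMn N (e c') (expR _)) (mulrA N%:R (e c' ^+ N)).
    (* The exponential growth in z goes into the constant K >= 1 of that lemma, the decay into B. *)
    apply: (@normc_pw_sum_le R n M' m s.+1 c' z
              (e c' * expR (L * enormR (Re_vec z)))
              ((1 + enormC z) `^ (- A))).
    - move=> w; have := normc_pw_growth M' c' w z Am.
      by rewrite M'E.
    - rewrite mulr_ege1// -[leLHS]expR0 ler_expR mulr_ge0//.
      exact: sqrtr_ge0.
    - by apply: powR_le1; exact: enormC_ge0.
    - exact: sN.
  exists (N%:R * e c ^+ N * (N%:R * e (neg_conj c) ^+ N)).
    have e_gt0 c' : 0 < e c' := lt_le_trans ltr01 (e_ge1 c').
    by rewrite !mulr_gt0 ?exprn_gt0// ltr0n.
  move=> z; rewrite normcM.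
  have /andP[p0 p1] := powR_le1 _ (enormC_ge0 z).
  set p := (1 + enormC z) `^ (- A) in p0 p1 *.
  set x := enormR (Re_vec z).
  have x0 : 0 <= x by exact: sqrtr_ge0.
  have := growth (- M) (neg_conj c) z (normrN _).
  have := growth M c z erefl; rewrite -/p -/x.
  set E := expR (N%:R * L * x).
  have E0 : 0 <= E by exact: expR_ge0.
  move=> h1 h2.
  apply: (le_trans (ler_pM (normc_ge0 _) (normc_ge0 _) h1 h2)).
  have e0 c' : 0 <= N%:R * e c' ^+ N.
    by rewrite mulr_ge0// exprn_ge0// (le_trans ler01).
  have reorder (a b : R) :
    a * E * p * (b * E * p) = a * b * ((E * E) * (p * p)) by ring.
  rewrite reorder; apply: ler_wpM2l; first exact: mulr_ge0 (e0 _) (e0 _).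
  (* One decay factor suffices, as p * p <= p; the two exponentials multiply to the rate 2 N L. *)
  apply: ler_pM; rewrite ?mulr_ge0//; last by rewrite ler_piMr.
  have dbl (a b : R) : (2 * a * b + 1) * x = a * b * x + a * b * x + x by ring.
  by rewrite -expRD ler_expR dbl lerDl.
- move=> z z_fixed maj; apply: sqr_le => // [|w]; last exact: distC_bound.
  by apply: powR_le1; apply: orbit_dist_ge0 => t; exact: enormC_ge0.
- move=> z z_fixed maj; apply: sqr_le => // [|w]; last exact: distR_bound.
  rewrite expR_ge0 expR_le1 oppr_le0 mulr_ge0 ?(ltW A_gt0)//.
  by apply: orbit_dist_ge0 => t; exact: sqrtr_ge0.
split.
  rewrite -[leRHS]mulr1; apply: (sqr_le z0 1 z0_fixed _ _).2.
    by rewrite ler01 lexx.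
  move=> w; rewrite (le_trans (distC_bound z0 w maj0))// ler_wpM2l ?(ltW K_gt0)//.
  suff /powR_le1/andP[] : 0 <= distC z0 z0 by [].
  by apply: orbit_dist_ge0 => t; exact: enormC_ge0.
(* The choice of s gives |g(z0)| >= q, so h(z0) = |g(z0)|^2 >= q^2. *)
rewrite hE// -rmorphM (_ : 1 = 1%:C)// lecR.
rewrite ler_pdivlMl ?exprn_gt0// mulr1.
apply: lerXn2r; rewrite ?nnegrE ?normc_ge0 ?(ltW q_gt0)//.
move: s_large; rewrite normr_normc -lecR; apply: le_trans.
by rewrite /q fmorphV rmorph_nat.
Qed.
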